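(* Let $R$ be an indecomposable commutative ring, $P$ a set and $\Pi=\prod_{x\in P}Re_x$. Then $$\operatorname{Aut}(\Pi)=\{\widehat\rho:\ \rho\text{ is a permutation of }P\}.$$
   Context: A commutative ring $R$ with identity is indecomposable if $0,1$ are its only idempotents. $\Pi=\prod_{x\in P}Re_x$ is the full cartesian product of $|P|$ copies of $R$, an $R$-algebra with componentwise operations; its elements are written $a=\sum_{x\in P}a_xe_x$ with arbitrary $a_x\in R$. $\operatorname{Aut}(\Pi)$ is the set of $R$-algebra automorphisms of $\Pi$. For a permutation $\rho$ of $P$, $\widehat\rho:\Pi\to\Pi$ is defined by $\widehat\rho\left(\sum_{x\in P}a_xe_x\right)=\sum_{x\in P}a_xe_{\rho(x)}$. *)

(* Defs.v *)
From HB Require Import structures.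
From mathcomp Require Import all_boot all_algebra.
From mathcomp Require Import boolp classical_sets functions.

Set Implicit Arguments.
Unset Strict Implicit.
Unset Printing Implicit Defensive.

Import GRing.Theory.
Local Open Scope classical_set_scope.
Local Open Scope ring_scope.

Definition indecomposable (R : pzRingType) : Prop :=
  forall e : R, e * e = e -> e = 0 \/ e = 1.

(* The element \sum_x a_x e_x is the function x |-> a_x; the regular module R^o
   gives P -> R^o its componentwise scaling. The structure algType is restricted to
   nonzero rings, which would exclude P empty and R = 0, so the R-algebra
   structure is carried by the ring and module instances, whose compatibility
   is full_product_scalerAl and full_product_scalerAr. *)
Definition full_product (R : comPzRingType) (P : Type) : Type := P -> R^o.

HB.instance Definition _ (R : comPzRingType) (P : Type) :=
  GRing.ComPzRing.copy (full_product R P) (P -> R^o).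
HB.instance Definition _ (R : comPzRingType) (P : Type) :=
  GRing.Lmodule.copy (full_product R P) (P -> R^o).

Section FullProduct.
Variables (R : comPzRingType) (P : Type).
Implicit Types (a b : full_product R P) (k : R) (x : P).

Lemma full_productD a b x : (a + b) x = a x + b x. Proof. by []. Qed.
Lemma full_productM a b x : (a * b) x = a x * b x. Proof. by []. Qed.
Lemma full_product1 x : (1 : full_product R P) x = 1. Proof. by []. Qed.
Lemma full_productZ k a x : (k *: a) x = k * a x. Proof. by []. Qed.

Lemma full_product_scalerAl k a b : k *: (a * b) = k *: a * b.
Proof. by apply/funext => x; apply: mulrA. Qed.

Lemma full_product_scalerAr k a b : k *: (a * b) = a * (k *: b).
Proof. by rewrite mulrC full_product_scalerAl mulrC. Qed.

Definition algebra_automorphisms : set (full_product R P -> full_product R P) :=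
  [set f : full_product R P -> full_product R P |
    [/\ linear f, monoid_morphism f & bijective f]].

(* {splitbij [set: P] >-> [set: P]} is the type of permutations of P bundled
   with their inverse; the coefficient of e_y in \sum_x a_x e_(rho x) is
   a_(rho^-1 y). *)
Definition hat (rho : {splitbij [set: P] >-> [set: P]}) a : full_product R P :=
  fun y => a (rho^-1%FUN y).

Lemma hatE (rho : {splitbij [set: P] >-> [set: P]}) a x :
  hat rho a (rho x) = a x.
Proof. by rewrite /hat funK ?inE. Qed.

End FullProduct.

(* Main.v *)
(** The elements [e_x] are exactly the nonzero idempotents of the product lying
    below a single coordinate: as [R] has only the idempotents [0] and [1], an
    idempotent [b <> 0] has some coordinate equal to [1], so [b] dominates some
    [e_x], and any idempotent multiple of [e_y] is [0] or [e_y]. Hence a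
    multiplicative bijection fixing [0] permutes the [e_x]. Linearity is then
    only needed in the identity [a e_x = a_x e_x], whose image under [f] reads
    [f(a) e_(rho x) = a_x e_(rho x)]: no continuity with respect to infinite
    sums is involved. *)
Require Import Defs.
From HB Require Import structures.
From mathcomp Require Import all_boot all_algebra.
From mathcomp Require Import boolp classical_sets functions.
Import GRing.Theory.
Local Open Scope classical_set_scope.
Local Open Scope ring_scope.

Lemma hat_automorphism (R : comPzRingType) (P : Type)
    (rho : {splitbij [set: P] >-> [set: P]}) :
  @algebra_automorphisms R P (hat rho).
Proof.
(* Linearity and multiplicativity hold by computation, as [hat rho] only reindexes coordinates;
   precomposing with [rho] undoes it. *)
split=> //; exists (fun a : full_product R P => (a \o rho : full_product R P)).
  by move=> a; apply/funext => x; apply: hatE.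
by move=> a; apply/funext => y; rewrite /hat /= invK ?inE.
Qed.

Section CoordinateIdempotents.
Variables (R : comPzRingType) (P : Type).
Local Notation Pi := (full_product R P).

Definition coord_idem (x : P) : Pi := fun y => if `[< x = y >] then 1 else 0.

Lemma coord_idem_id x : coord_idem x x = 1.
Proof. by rewrite /coord_idem asboolT. Qed.

Lemma mul_coord_idem (a : Pi) x : a * coord_idem x = a x *: coord_idem x.
Proof.
apply/funext => y; rewrite full_productM full_productZ /coord_idem.
by case: asboolP => [->|_] //; rewrite !mulr0.
Qed.

Lemma coord_idem_idem x : coord_idem x * coord_idem x = coord_idem x.
Proof. by rewrite mul_coord_idem coord_idem_id scale1r. Qed.

Hypothesis R_neq0 : (1 : R) <> 0.

Lemma coord_idem_neq0 x : coord_idem x <> 0.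
Proof. by move/(congr1 (@^~ x)); rewrite coord_idem_id. Qed.

Lemma coord_idem_inj x y : coord_idem x = coord_idem y -> x = y.
Proof.
move/(congr1 (@^~ x)); rewrite coord_idem_id /coord_idem.
by case: asboolP => [->|].
Qed.

Hypothesis hR : indecomposable R.

(** Phrased for multiplicative bijections so that it serves both an automorphism and its inverse. *)
Lemma coord_idem_preimage (f g : Pi -> Pi) :
    cancel f g -> cancel g f -> {morph f : a b / a * b} -> f 0 = 0 ->
  forall y, exists x, f (coord_idem x) = coord_idem y.
Proof.
move=> fK gK fM f0 y; set b := g (coord_idem y).
have fb : f b = coord_idem y by apply: gK.
have bb : b * b = b by apply: (can_inj fK); rewrite fM fb coord_idem_idem.
have [x bx0] : exists x, b x <> 0.
  apply: contrapT => /forallNP b0; apply: (@coord_idem_neq0 y).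
  rewrite -fb -f0; congr f; apply/funext => x; exact: contrapT (b0 x).
have {bx0} bx1 : b x = 1.
  by case: (hR (b x)) => //; rewrite -full_productM bb.
exists x; set c := f (coord_idem x) y.
(* Since [b x = 1], [b] dominates [e_x], so [f e_x = f (e_x * b) = f e_x * e_y]. *)
have fx : f (coord_idem x) = c *: coord_idem y.
  by rewrite -mul_coord_idem -fb -fM mulrC mul_coord_idem bx1 scale1r.
have cc : c * c = c by rewrite /c -full_productM -fM coord_idem_idem.
have [c0|c1] := hR c cc; last by rewrite fx c1 scale1r.
case: (@coord_idem_neq0 x); apply: (can_inj fK).
by rewrite f0 fx c0 scale0r.
Qed.

Lemma automorphism_hat (f : Pi -> Pi) :
  algebra_automorphisms f -> exists rho, hat rho = f.
Proof.
move=> [f_lin [_ fM] [g fK gK]].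
have f0 : f 0 = 0.
  by have := f_lin (-1) 0 0; rewrite scaler0 addr0 scaleN1r addNr.
have fZ k a : f (k *: a) = k *: f a.
  by have := f_lin k a 0; rewrite f0 !addr0.
have gM : {morph g : a b / a * b}.
  by move=> a b; apply: (can_inj fK); rewrite fM !gK.
have g0 : g 0 = 0 by rewrite -f0 fK.
(* Preimages under [f] give [sigma]; preimages under [g] give [rho], with [g e_(rho x) = e_x]. The
   two are mutually inverse. *)
have [sigma sigmaE] := choice (coord_idem_preimage f g fK gK fM f0).
have [rho rhoE] := choice (coord_idem_preimage g f gK fK gM g0).
have {}rhoE x : f (coord_idem x) = coord_idem (rho x) by rewrite -rhoE gK.
have rho_bij : bijective rho.
  exists sigma => [x|y]; apply: coord_idem_inj.
    by apply: (can_inj fK); rewrite sigmaE rhoE.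
  by rewrite -rhoE sigmaE.
have f_rho a x : f a (rho x) = a x.
  have : f a * coord_idem (rho x) = a x *: coord_idem (rho x).
    by rewrite -rhoE -fM mul_coord_idem fZ.
  move/(congr1 (@^~ (rho x))).
  by rewrite full_productM full_productZ coord_idem_id !mulr1.
have [s rho_s] := PbijTT rho_bij.
exists s; apply/funext => a; apply/funext => y.
by rewrite /hat -f_rho rho_s invK ?inE.
Qed.

End CoordinateIdempotents.

Theorem proposition3p2 (R : comPzRingType) (P : Type) (hR : indecomposable R) :
  @algebra_automorphisms R P =
  [set @hat R P rho | rho in [set: {splitbij [set: P] >-> [set: P]}]].
Proof.
apply/seteqP; split=> [f f_aut | _ [rho _ <-]]; last exact: hat_automorphism.
(* If [1 = 0], every [e_x] is [0] and no longer determines [x]; but then the product has one element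
   and the identity permutation serves. *)
have [R0|R_neq0] := pselect ((1 : R) = 0); last first.
  by have [rho <-] := automorphism_hat R P R_neq0 hR f f_aut; exists rho.
have Pi0 (a b : full_product R P) : a = b.
  by apply/funext => x; rewrite -[a x]mulr1 -[b x]mulr1 R0 !mulr0.
by exists [splitbij of idfun] => //; apply/funext => a; apply: Pi0.
Qed.
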